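(* Let $\varphi$ be a $C^1$-process on $\mathbb{I}$ with $\varphi(\cdot,t_-,0)=0$ and let $\Phi\in\mathcal{LP}(\mathbb{I},\mathbb{R}^n)$ be the linearization of $\varphi$ along $\varphi(\cdot,t_-,0)=0$. If the function $m$ is continuous at $0$, then for any $X,Y\in\mathrm{Gr}(1,\mathbb{R}^n)$ with $X\subseteq V^{\mathrm s}(\Phi)$ and $Y\subseteq V^{\mathrm u}(\Phi)$ one has $\eta(X)>0$ and $\hat\eta(Y)>0$. Moreover, $\eta$ and $\hat\eta$ are bounded away from zero on compact subsets of $V^{\mathrm s}(\Phi)$ and $V^{\mathrm u}(\Phi)$, respectively (the cones being regarded as subsets of $\mathrm{Gr}(1,\mathbb{R}^n)$).
   Context: Let $n\ge 1$, let $|\cdot|$ be an arbitrary fixed norm on $\mathbb{R}^n$ with unit sphere $\mathcal{S}$, closed balls $B[0,\delta]$ and induced operator norm $\|\cdot\|$. Let $\mathbb{I}\subset\mathbb{R}$ be compact (not necessarily an interval), $t_-=\min\mathbb{I}<t_+=\max\mathbb{I}$. Put $\mathbb{I}^2_{\neq}=\{(t,s)\in\mathbb{I}\times\mathbb{I}: t\neq s\}$ with closure $\overline{\mathbb{I}^2_{\neq}}$ in $\mathbb{R}^2$. A process on $\mathbb{I}$ is a continuous map $\varphi:\mathbb{I}\times\mathbb{I}\times\mathbb{R}^n\to\mathbb{R}^n$, $(t,s,x)\mapsto\varphi(t,s,x)$, Lipschitz continuous in the first argument, with $\varphi(t,t,\cdot)=\mathrm{id}$ and $\varphi(t,s,\cdot)\circ\varphi(s,r,\cdot)=\varphi(t,r,\cdot)$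 for all $t,s,r\in\mathbb{I}$. It is a $C^k$-process ($k\ge1$) if $\varphi(t,s,\cdot)\in C^k(\mathbb{R}^n,\mathbb{R}^n)$ for all $t,s$ and the space derivative $t\mapsto\partial_x\varphi(t,s,x)$ is Lipschitz continuous for all $s,x$. A linear process is a process $\Phi(t,s,x)=\Phi(t,s)x$ with $\Phi(t,s)\in GL(n,\mathbb{R})$ and $t\mapsto\Phi(t,s)$ Lipschitz continuous in operator norm. For continuous $f:\mathbb{I}\to(0,\infty)$ let $\Delta(f)(t,s)=\frac{\ln f(t)-\ln f(s)}{t-s}$, $(t,s)\in\mathbb{I}^2_{\neq}$. Standing assumption: $\mathcal{LP}(\mathbb{I},\mathbb{R}^n)$ is the set of linear processes $\Phi$ for which $(x,t,s)\mapsto\Delta(|\Phi(\cdot,t_-)x|)(t,s)$ extends continuously from $\mathcal{S}\times\mathbb{I}^2_{\neq}$ to $\mathcal{S}\times\overline{\mathbb{I}^2_{\neq}}$ (same symbol for the extension). The linearization of $\varphi$ along $\varphi(\cdot,t_-,x)$ is $\Phi(t,s)=\partial_x\varphi(t,s,\varphi(s,t_-,x))$; along the zero trajectory, $\Phi(t,s)=\partial_x\varphi(t,s,0)$. $\mathrm{Gr}(1,\mathbb{R}^n)$ is the set of one-dimensional subspaces, with the metric $\Theta(L,M)=\|\pi_L-\pi_M\|$, $\pi_X$ the Euclidean orthogonal projection onto $X$. For $X\in\mathrm{Gr}(1,\mathbb{R}^n)$, $\underline{\lambda}(X,\Phi)$ and $\overline{\lambda}(X,\Phi)$ are the minimum and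 maximum of $\Delta(|\Phi(\cdot,t_-)x|)(t,s)$ over $x\in X\cap\mathcal{S}$, $(t,s)\in\overline{\mathbb{I}^2_{\neq}}$. Stable and unstable cones: $V^{\mathrm s}(\Phi)=\bigcup\{X\in\mathrm{Gr}(1,\mathbb{R}^n):\overline{\lambda}(X,\Phi)<0\}$, $V^{\mathrm u}(\Phi)=\bigcup\{X\in\mathrm{Gr}(1,\mathbb{R}^n):\underline{\lambda}(X,\Phi)>0\}$; they are identified with the corresponding sets of one-dimensional subspaces. For $x\neq0$ and a process $\psi$ whose zero trajectory is $\psi(\cdot,t_-,0)=0$ put $\underline{\mu}(x,\psi)=\inf_{(t,s)\in\mathbb{I}^2_{\neq}}\Delta(|\psi(\cdot,t_-,x)|)(t,s)$ and $\overline{\mu}(x,\psi)=\sup_{(t,s)\in\mathbb{I}^2_{\neq}}\Delta(|\psi(\cdot,t_-,x)|)(t,s)$. Define $m(0)=0$ and, for $r>0$, $$m(r)=\sup_{x\in B[0,r]\setminus\{0\}}\max\{|\underline{\mu}(x,\varphi)-\underline{\mu}(x,\Phi)|,|\overline{\mu}(x,\varphi)-\overline{\mu}(x,\Phi)|\}\in[0,\infty].$$ Domains of attraction and repulsion of the zero trajectory: $W^{\mathrm s}_0=\{x\neq0:\overline{\mu}(x,\varphi)<0\}\cup\{0\}$, $W^{\mathrm u}_0=\{x\neq0:\underline{\mu}(x,\varphi)>0\}\cup\{0\}$. For $X\in\mathrm{Gr}(1,\mathbb{R}^n)$: $\eta(X)=\inf\{r>0:\exists x\in X\cap\mathcal{S},\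 rx\notin W^{\mathrm s}_0\}$ and $\hat\eta(X)=\inf\{r>0:\exists x\in X\cap\mathcal{S},\ rx\notin W^{\mathrm u}_0\}$, with $\inf\emptyset=\infty$. *)

(* Defs.v *)
From HB Require Import structures.
From mathcomp Require Import all_boot all_order all_algebra.
From mathcomp Require Import all_classical all_reals all_analysis.

Set Implicit Arguments.
Unset Strict Implicit.
Unset Printing Implicit Defensive.

Import Order.TTheory GRing.Theory Num.Theory.
Import numFieldNormedType.Exports.

Local Open Scope classical_set_scope.
Local Open Scope ring_scope.

(* R^n is 'rV[R]_n with its usual topology.  As in the library's jacobian,
   a matrix A stands for the linear map x |-> x *m A. *)

Record vector_norm (R : realType) (n : nat) := VectorNorm {
  vnorm :> 'rV[R]_n -> R;
  vnorm_triangle : forall x y, vnorm (x + y) <= vnorm x + vnorm y;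
  vnormZ : forall a x, vnorm (a *: x) = `|a| * vnorm x;
  vnorm_eq0 : forall x, vnorm x = 0 -> x = 0
}.

Definition unit_sphere (R : realType) (n : nat) (N : vector_norm R n) :
    set 'rV[R]_n :=
  [set x | N x = 1].

Definition opnorm (R : realType) (n : nat) (N : vector_norm R n)
    (A : 'M[R]_n) : R :=
  sup [set N (x *m A) | x in unit_sphere N].

(* The value is 0 when A has no minimum, resp. maximum. *)
Definition set_min (R : realType) (A : set R) : R :=
  xget 0 [set a | A a /\ lbound A a].

Definition set_max (R : realType) (A : set R) : R :=
  xget 0 [set a | A a /\ ubound A a].

(** * The Grassmannian Gr(1, R^n) *)

Definition dotv (R : realType) (n : nat) (x y : 'rV[R]_n) : R :=
  \sum_(i < n) x 0 i * y 0 i.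

Definition is_orth_proj (R : realType) (n : nat) (X : {vspace 'rV[R]_n})
    (P : 'M[R]_n) : Prop :=
  forall v, v *m P \in X /\ (forall w, w \in X -> dotv (v - v *m P) w = 0).

Definition orth_proj (R : realType) (n : nat) (X : {vspace 'rV[R]_n}) :
    'M[R]_n :=
  xget 0 (is_orth_proj X).

(* The norm is a parameter of the type because the metric depends on it. *)
Definition Gr1 (R : realType) (n : nat) (N : vector_norm R n) : Type :=
  {X : {vspace 'rV[R]_n} | \dim X == 1%N}.

HB.instance Definition _ (R : realType) (n : nat) (N : vector_norm R n) :=
  Choice.on (Gr1 N).

Definition line_set (R : realType) (n : nat) (N : vector_norm R n)
    (X : Gr1 N) : set 'rV[R]_n :=
  [set x | x \in val X].

Definition Theta (R : realType) (n : nat) (N : vector_norm R n)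
    (X Y : Gr1 N) : R :=
  opnorm N (orth_proj (val X) - orth_proj (val Y)).

Lemma vnorm0 (R : realType) (n : nat) (N : vector_norm R n) : N 0 = 0.
Proof. by rewrite -[X in N X](scale0r 0) vnormZ normr0 mul0r. Qed.

Lemma vnormN (R : realType) (n : nat) (N : vector_norm R n) x : N (- x) = N x.
Proof. by rewrite -scaleN1r vnormZ normrN1 mul1r. Qed.

Lemma vnorm_ge0 (R : realType) (n : nat) (N : vector_norm R n) x : 0 <= N x.
Proof.
have := vnorm_triangle N x (- x).
by rewrite subrr vnorm0 vnormN -mulr2n pmulrn_lge0.
Qed.

Lemma mx_coord_le (R : realType) (n : nat) (x : 'rV[R]_n) i : `|x 0 i| <= `|x|.
Proof.
rewrite [leRHS]/Num.Def.normr /= mx_normrE; apply/bigmax_geP; right => /=.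
by exists (0, i).
Qed.

Lemma vnorm_le_mx_norm (R : realType) (n : nat) (N : vector_norm R n) :
  exists2 C, 0 <= C & forall x : 'rV[R]_n, N x <= C * `|x|.
Proof.
exists (\sum_(i < n) N (delta_mx 0 i)).
  by apply: sumr_ge0 => i _; exact: vnorm_ge0.
move=> x; rewrite {1}[x]row_sum_delta.
apply: (@le_trans _ _ (\sum_(i < n) N (x 0 i *: delta_mx 0 i))).
  elim/big_ind2 : _ => [|a b c d ab cd|//]; first by rewrite vnorm0.
  by rewrite (le_trans (vnorm_triangle _ _ _))// lerD.
rewrite mulr_suml; apply: ler_sum => i _.
by rewrite vnormZ mulrC ler_wpM2l ?vnorm_ge0// mx_coord_le.
Qed.

Lemma vnorm_dist_le (R : realType) (n : nat) (N : vector_norm R n) x y :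
  `|N x - N y| <= N (x - y).
Proof.
have H a b : N a - N b <= N (a - b).
  by rewrite lerBlDr -{1}(subrK b a) vnorm_triangle.
by rewrite ler_norml H andbT lerNl opprB -(vnormN N (x - y)) opprB H.
Qed.

Lemma vnorm_continuous (R : realType) (n : nat) (N : vector_norm R n) :
  continuous (N : 'rV[R]_n -> R).
Proof.
have [C C0 HC] := vnorm_le_mx_norm N.
move=> x; apply/(@cvgrPdist_le _ _ _ (nbhs x) (nbhs_filter x)) => e e0.
have C1 : 0 < C + 1 by rewrite ltr_pwDr.
apply/nbhs_ballP; exists (e / (C + 1)) => /=; first by rewrite divr_gt0.
move=> y; rewrite -ball_normE /= ltr_pdivlMr// => xy.
apply: (le_trans (vnorm_dist_le _ _ _)); apply: (le_trans (HC _)).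
by apply: le_trans (ltW xy); rewrite mulrC ler_wpM2l// lerDl.
Qed.

Lemma mx_norm_le_vnorm (R : realType) (n : nat) (N : vector_norm R n) :
  exists2 c, 0 < c & forall x : 'rV[R]_n, c * `|x| <= N x.
Proof.
pose S := [set x : 'rV[R]_n | `|x| = 1].
have [S0|/set0P S0] := eqVneq S set0.
  exists 1 => // x; have [->|x0] := eqVneq x 0.
    by rewrite normr0 mulr0 vnorm_ge0.
  have : S (`|x|^-1 *: x).
    by rewrite /S /= normrZ normfV normr_id mulVf// normr_eq0.
  by rewrite S0.
have cS : compact S.
  apply: bounded_closed_compact.
    by exists 1; split=> // M M1 x /= ->; exact: ltW.
  have -> : S = (fun x : 'rV[R]_n => `|x|) @^-1` [set 1] by [].
  apply: closed_comp; last exact: closed_eq.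
  by move=> x _; exact: norm_continuous.
have [c Sc Hc] := compact_EVT_min S0 cS
  (continuous_subspaceT (@vnorm_continuous _ _ N)).
exists (N c).
  rewrite lt_def vnorm_ge0 andbT; apply/eqP => /vnorm_eq0 c0.
  have : `|c| = 1 by move: Sc; rewrite inE.
  by rewrite c0 normr0 => /eqP; rewrite eq_sym oner_eq0.
move=> x; have [->|x0] := eqVneq x 0.
  by rewrite normr0 mulr0 vnorm_ge0.
have nx0 : 0 < `|x| by rewrite normr_gt0.
have /Hc : (`|x|^-1 *: x) \in S.
  by rewrite inE /S /= normrZ normfV normr_id mulVf// gt_eqF.
by rewrite vnormZ normfV normr_id mulrC ler_pdivlMr.
Qed.

Lemma opnorm_has_ubound (R : realType) (n : nat) (N : vector_norm R n)
    (A : 'M[R]_n) :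
  has_ubound [set N (x *m A) | x in unit_sphere N].
Proof.
have [C C0 HC] := vnorm_le_mx_norm N.
have [c c0 Hc] := mx_norm_le_vnorm N.
exists (\sum_(i < n) c^-1 * N (row i A)) => _ [x /= x1 <-].
rewrite mulmx_sum_row.
apply: (@le_trans _ _ (\sum_(i < n) N (x 0 i *: row i A))).
  elim/big_ind2 : _ => [|a b d e ab de|//]; first by rewrite vnorm0.
  by rewrite (le_trans (vnorm_triangle _ _ _))// lerD.
apply: ler_sum => i _; rewrite vnormZ ler_wpM2r ?vnorm_ge0//.
rewrite (le_trans (mx_coord_le x i))// -(ler_pM2l c0) divff ?gt_eqF//.
by rewrite (le_trans (Hc x))// x1.
Qed.

Lemma vnorm_mulmx_le (R : realType) (n : nat) (N : vector_norm R n)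
    (A : 'M[R]_n) x :
  N (x *m A) <= opnorm N A * N x.
Proof.
have [->|x0] := eqVneq x 0; first by rewrite mul0mx vnorm0 mulr0.
have Nx0 : 0 < N x.
  by rewrite lt_def vnorm_ge0 andbT; apply: contra x0 => /eqP/vnorm_eq0 ->.
rewrite -ler_pdivrMr// mulrC.
have -> : (N x)^-1 * N (x *m A) = N (((N x)^-1 *: x) *m A).
  by rewrite -scalemxAl vnormZ ger0_norm// invr_ge0 ltW.
apply: sup_ubound; first exact: opnorm_has_ubound.
exists ((N x)^-1 *: x) => //.
by rewrite /unit_sphere /= vnormZ ger0_norm ?invr_ge0 ?ltW// mulVf// gt_eqF.
Qed.

Lemma opnorm_le (R : realType) (n : nat) (N : vector_norm R n)
    (A : 'M[R]_n) c :
  0 <= c -> (forall x, N (x *m A) <= c * N x) -> opnorm N A <= c.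
Proof.
move=> c0 H; rewrite /opnorm.
have [->|/set0P ne] := eqVneq [set N (x *m A) | x in unit_sphere N] set0.
  by rewrite sup0.
by apply: sup_le_ub => // _ [x /= x1 <-]; rewrite (le_trans (H x))// x1 mulr1.
Qed.

Lemma opnorm_ge0 (R : realType) (n : nat) (N : vector_norm R n) (A : 'M[R]_n) :
  0 <= opnorm N A.
Proof.
rewrite /opnorm.
have [->|/set0P [y [x x1 _]]] :=
    eqVneq [set N (x *m A) | x in unit_sphere N] set0; first by rewrite sup0.
apply: (le_trans (vnorm_ge0 N (x *m A))).
by apply: sup_ubound; [exact: opnorm_has_ubound | exists x].
Qed.

Lemma opnormD (R : realType) (n : nat) (N : vector_norm R n) (A B : 'M[R]_n) :
  opnorm N (A + B) <= opnorm N A + opnorm N B.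
Proof.
apply: opnorm_le => [|x]; first by rewrite addr_ge0 ?opnorm_ge0.
rewrite mulmxDr (le_trans (vnorm_triangle _ _ _))// mulrDl.
by rewrite lerD ?vnorm_mulmx_le.
Qed.

Lemma opnormN (R : realType) (n : nat) (N : vector_norm R n) (A : 'M[R]_n) :
  opnorm N (- A) = opnorm N A.
Proof.
rewrite /opnorm; congr (sup _); apply: eq_imagel => x _.
by rewrite mulmxN vnormN.
Qed.

Lemma opnorm_eq0 (R : realType) (n : nat) (N : vector_norm R n) (A : 'M[R]_n) :
  opnorm N A = 0 -> A = 0.
Proof.
move=> A0; apply/row_matrixP => i; rewrite rowE row0; apply: (@vnorm_eq0 _ _ N).
apply/eqP; rewrite eq_le vnorm_ge0 andbT.
by have := vnorm_mulmx_le N A (delta_mx 0 i); rewrite A0 mul0r.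
Qed.

Lemma dotvv_eq0 (R : realType) (n : nat) (x : 'rV[R]_n) : dotv x x = 0 -> x = 0.
Proof.
move=> /eqP; rewrite psumr_eq0; last by move=> i _; rewrite -expr2 sqr_ge0.
move=> /allP H; apply/rowP => i; rewrite mxE.
by have := H i (mem_index_enum i); rewrite /= mulf_eq0 orbb => /eqP.
Qed.

Lemma dotvE (R : realType) (n : nat) (x y : 'rV[R]_n) :
  x *m y^T = (dotv x y)%:M.
Proof.
by apply/matrixP => i j; rewrite !ord1 !mxE eqxx; apply: eq_bigr => k _; rewrite mxE.
Qed.

Lemma is_orth_proj_line (R : realType) (n : nat) (u : 'rV[R]_n) :
  u != 0 -> is_orth_proj <[u]>%VS ((dotv u u)^-1 *: (u^T *m u)).
Proof.
move=> u0 v.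
have uu : dotv u u != 0 by apply: contra u0 => /eqP/dotvv_eq0 ->.
have E : v *m ((dotv u u)^-1 *: (u^T *m u)) = (dotv v u / dotv u u) *: u.
  by rewrite -scalemxAr mulmxA dotvE mul_scalar_mx scalerA mulrC.
rewrite E; split; first by apply/vlineP; exists (dotv v u / dotv u u).
move=> _ /vlineP[k ->].
have dZ a (x y : 'rV[R]_n) : dotv x (a *: y) = a * dotv x y.
  by rewrite /dotv mulr_sumr; apply: eq_bigr => i _; rewrite mxE mulrCA.
have dB c : dotv (v - c *: u) u = dotv v u - c * dotv u u.
  rewrite /dotv mulr_sumr -sumrB; apply: eq_bigr => i _.
  by rewrite !mxE mulrBl mulrA.
by rewrite dZ dB divfK// subrr mulr0.
Qed.

Lemma dim1_vline (R : realType) (n : nat) (X : {vspace 'rV[R]_n}) :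
  \dim X == 1%N -> exists2 u, u != 0 & X = <[u]>%VS.
Proof.
move=> /eqP X1; have X0 : X != 0%VS by rewrite -dimv_eq0 X1.
exists (vpick X); first by rewrite vpick0.
apply/esym/eqP; rewrite eqEdim dim_vline vpick0 X0 X1 andbT.
by rewrite -memvE memv_pick.
Qed.

Lemma orth_projP (R : realType) (n : nat) (X : {vspace 'rV[R]_n}) :
  \dim X == 1%N -> is_orth_proj X (orth_proj X).
Proof.
move=> /dim1_vline[u u0 ->]; apply: (@xgetPex _ 0).
by eexists; exact: is_orth_proj_line u0.
Qed.

Lemma orth_proj_id (R : realType) (n : nat) (X : {vspace 'rV[R]_n}) v :
  \dim X == 1%N -> v \in X -> v *m orth_proj X = v.
Proof.
move=> X1 vX; have [PX H] := orth_projP X1 v.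
by apply/esym/eqP; rewrite -subr_eq0; apply/eqP/dotvv_eq0/H; rewrite rpredB.
Qed.

Lemma Thetaxx (R : realType) (n : nat) (N : vector_norm R n) (X : Gr1 N) :
  Theta X X = 0.
Proof.
apply/eqP; rewrite eq_le opnorm_ge0 andbT.
by apply: opnorm_le => // x; rewrite subrr mulmx0 vnorm0 mul0r.
Qed.

Lemma Theta_eq0 (R : realType) (n : nat) (N : vector_norm R n) (X Y : Gr1 N) :
  Theta X Y = 0 -> X = Y.
Proof.
move=> /opnorm_eq0/eqP; rewrite subr_eq0 => /eqP E.
have sub (A B : Gr1 N) : orth_proj (val A) = orth_proj (val B) ->
    (val A <= val B)%VS.
  move=> AB; apply/subvP => v vA.
  rewrite -(orth_proj_id (valP A) vA) AB.
  by have [] := orth_projP (valP B) v.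
by apply/val_inj/eqP; rewrite eqEsubv !sub.
Qed.

Lemma ThetaC (R : realType) (n : nat) (N : vector_norm R n) (X Y : Gr1 N) :
  Theta X Y = Theta Y X.
Proof. by rewrite /Theta -opnormN opprB. Qed.

Lemma Theta_triangle (R : realType) (n : nat) (N : vector_norm R n)
    (Y X Z : Gr1 N) :
  Theta X Z <= Theta X Y + Theta Y Z.
Proof. by rewrite /Theta (le_trans _ (opnormD _ _ _))// addrA subrK. Qed.

HB.instance Definition _ (R : realType) (n : nat) (N : vector_norm R n) :=
  isMetric.Build R (Gr1 N) (@Thetaxx R n N) (@Theta_eq0 R n N)
    (@ThetaC R n N) (@Theta_triangle R n N).

(** * Processes *)

(* A map on I x I x R^n is represented by a total function of which only the
   values at t, s in I are ever used. *)

Definition is_process (R : realType) (n : nat) (N : vector_norm R n)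
    (I : set R) (phi : R -> R -> 'rV[R]_n -> 'rV[R]_n) : Prop :=
  [/\ {within I `*` I `*` setT,
        continuous (fun p : R * R * 'rV[R]_n => phi p.1.1 p.1.2 p.2)},
      forall s x, I s -> exists L : R, forall t t', I t -> I t' ->
        N (phi t s x - phi t' s x) <= L * `|t - t'|,
      forall t x, I t -> phi t t x = x &
      forall t s r x, I t -> I s -> I r ->
        phi t s (phi s r x) = phi t r x].

Definition is_C1_process (R : realType) (n : nat) (N : vector_norm R n)
    (I : set R) (phi : R -> R -> 'rV[R]_n -> 'rV[R]_n) : Prop :=
  [/\ is_process N I phi,
      forall t s, I t -> I s ->
        (forall x, differentiable (phi t s) x) /\
        continuous (jacobian (phi t s)) &
      forall s x, I s -> exists L : R, forall t t', I t -> I t' ->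
        opnorm N (jacobian (phi t s) x - jacobian (phi t' s) x)
          <= L * `|t - t'|].

Definition lin_process (R : realType) (n : nat) (Phi : R -> R -> 'M[R]_n) :
    R -> R -> 'rV[R]_n -> 'rV[R]_n :=
  fun t s x => x *m Phi t s.

Definition is_linear_process (R : realType) (n : nat) (N : vector_norm R n)
    (I : set R) (Phi : R -> R -> 'M[R]_n) : Prop :=
  [/\ is_process N I (lin_process Phi),
      forall t s, I t -> I s -> Phi t s \in unitmx &
      forall s, I s -> exists L : R, forall t t', I t -> I t' ->
        opnorm N (Phi t s - Phi t' s) <= L * `|t - t'|].

Definition linearization (R : realType) (n : nat) (tm : R)
    (phi : R -> R -> 'rV[R]_n -> 'rV[R]_n) (x : 'rV[R]_n) :
    R -> R -> 'M[R]_n :=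
  fun t s => jacobian (phi t s) (phi s tm x).

(** * Growth rates *)

Definition offdiag (R : realType) (I : set R) : set (R * R) :=
  [set p | [/\ I p.1, I p.2 & p.1 != p.2]].

Definition Delta (R : realType) (f : R -> R) (p : R * R) : R :=
  (ln (f p.1) - ln (f p.2)) / (p.1 - p.2).

(* Delta(|psi(., t_-, x)|) *)
Definition growth (R : realType) (n : nat) (N : vector_norm R n) (tm : R)
    (psi : R -> R -> 'rV[R]_n -> 'rV[R]_n) (x : 'rV[R]_n) : R * R -> R :=
  Delta (fun t => N (psi t tm x)).

Definition growth_extension (R : realType) (n : nat) (N : vector_norm R n)
    (I : set R) (tm : R) (Phi : R -> R -> 'M[R]_n)
    (D : 'rV[R]_n * (R * R) -> R) : Prop :=
  {within unit_sphere N `*` closure (offdiag I), continuous D} /\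
  forall x p, unit_sphere N x -> offdiag I p ->
    D (x, p) = growth N tm (lin_process Phi) x p.

Definition in_LP (R : realType) (n : nat) (N : vector_norm R n)
    (I : set R) (tm : R) (Phi : R -> R -> 'M[R]_n) : Prop :=
  is_linear_process N I Phi /\ exists D, growth_extension N I tm Phi D.

(* On unit_sphere N `*` closure (offdiag I), the only place where it is used,
   the extension is unique. *)
Definition growth_ext (R : realType) (n : nat) (N : vector_norm R n)
    (I : set R) (tm : R) (Phi : R -> R -> 'M[R]_n) :
    'rV[R]_n * (R * R) -> R :=
  xget (fun=> 0) (growth_extension N I tm Phi).

Definition line_growths (R : realType) (n : nat) (N : vector_norm R n)
    (I : set R) (tm : R) (Phi : R -> R -> 'M[R]_n) (X : Gr1 N) : set R :=
  [set growth_ext N I tm Phi q |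
    q in (line_set X `&` unit_sphere N) `*` closure (offdiag I)].

Definition lambda_min (R : realType) (n : nat) (N : vector_norm R n)
    (I : set R) (tm : R) (Phi : R -> R -> 'M[R]_n) (X : Gr1 N) : R :=
  set_min (line_growths I tm Phi X).

Definition lambda_max (R : realType) (n : nat) (N : vector_norm R n)
    (I : set R) (tm : R) (Phi : R -> R -> 'M[R]_n) (X : Gr1 N) : R :=
  set_max (line_growths I tm Phi X).

Definition stable_cone (R : realType) (n : nat) (N : vector_norm R n)
    (I : set R) (tm : R) (Phi : R -> R -> 'M[R]_n) : set 'rV[R]_n :=
  \bigcup_(X in [set X : Gr1 N | lambda_max I tm Phi X < 0]) line_set X.

Definition unstable_cone (R : realType) (n : nat) (N : vector_norm R n)
    (I : set R) (tm : R) (Phi : R -> R -> 'M[R]_n) : set 'rV[R]_n :=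
  \bigcup_(X in [set X : Gr1 N | 0 < lambda_min I tm Phi X]) line_set X.

Definition lines_in (R : realType) (n : nat) (N : vector_norm R n)
    (V : set 'rV[R]_n) : set (Gr1 N) :=
  [set X | line_set X `<=` V].

Definition mu_inf (R : realType) (n : nat) (N : vector_norm R n)
    (I : set R) (tm : R) (psi : R -> R -> 'rV[R]_n -> 'rV[R]_n)
    (x : 'rV[R]_n) : \bar R :=
  ereal_inf [set (growth N tm psi x p)%:E | p in offdiag I].

Definition mu_sup (R : realType) (n : nat) (N : vector_norm R n)
    (I : set R) (tm : R) (psi : R -> R -> 'rV[R]_n -> 'rV[R]_n)
    (x : 'rV[R]_n) : \bar R :=
  ereal_sup [set (growth N tm psi x p)%:E | p in offdiag I].

(* The function m of the radius. *)
Definition rate_deviation (R : realType) (n : nat) (N : vector_norm R n)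
    (I : set R) (tm : R) (phi : R -> R -> 'rV[R]_n -> 'rV[R]_n)
    (Phi : R -> R -> 'M[R]_n) (r : R) : \bar R :=
  if 0 < r then
    ereal_sup
      [set maxe
        `|mu_inf N I tm phi x - mu_inf N I tm (lin_process Phi) x|%E
        `|mu_sup N I tm phi x - mu_sup N I tm (lin_process Phi) x|%E
      | x in [set x | N x <= r /\ x != 0]]
  else 0%E.

(** * Domains of attraction and repulsion *)

Definition attraction_domain (R : realType) (n : nat) (N : vector_norm R n)
    (I : set R) (tm : R) (phi : R -> R -> 'rV[R]_n -> 'rV[R]_n) :
    set 'rV[R]_n :=
  [set x | x != 0 /\ (mu_sup N I tm phi x < 0)%E] `|` [set 0].

Definition repulsion_domain (R : realType) (n : nat) (N : vector_norm R n)
    (I : set R) (tm : R) (phi : R -> R -> 'rV[R]_n -> 'rV[R]_n) :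
    set 'rV[R]_n :=
  [set x | x != 0 /\ (0 < mu_inf N I tm phi x)%E] `|` [set 0].

(* eta for W the domain of attraction, \hat\eta for W that of repulsion;
   ereal_inf set0 = +oo. *)
Definition exit_radius (R : realType) (n : nat) (N : vector_norm R n)
    (W : set 'rV[R]_n) (X : Gr1 N) : \bar R :=
  ereal_inf [set r%:E | r in [set r : R | 0 < r /\
    exists x, [/\ line_set X x, unit_sphere N x & ~ W (r *: x)]]].

(* Main.v *)
Require Import Defs.
From mathcomp Require Import all_boot all_order all_algebra.
From mathcomp Require Import all_classical all_reals all_analysis.

Set Implicit Arguments.
Unset Strict Implicit.
Unset Printing Implicit Defensive.

Import Order.TTheory GRing.Theory Num.Theory.
Import numFieldNormedType.Exports.

Local Open Scope classical_set_scope.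
Local Open Scope ring_scope.

(** Growth rates of the linearization extend to a function D that is continuous
    on the product of the unit sphere and the closure of the off-diagonal pairs.
    A line in the stable cone is one on which D is negative.  The unit vectors on
    the lines of a compact set K form a compact set ([compact_unit_vectors]),
    which rests on the closedness of the relation that a vector lies on a line
    ([closed_incidence]).  So on a compact set of stable lines D is bounded
    above by some -d < 0 ([positive_gap] for -D).

    The linearization is homogeneous, hence its growth rates do not change when
    the initial vector is scaled ([growth_linearZ]), and its upper rates are at
    most -d along all lines of K.  Continuity of m at 0 yields a radius r0 with
    m(r0) < d ([rate_deviation_near0]), so in the ball of radius r0 the upper
    rates of the process differ from those of the linearization by less than d
    and remain negative.  Thus no line of K leaves the domain of attraction
    before r0.  The unstable case is the same with D bounded below by d, and the
    claim for single lines is the case of a one-point set K. *)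

(** * Lines and unit vectors *)

(** With P and Q the projections onto X and Y, y Q = y gives
    x P - x = (x - y) P - (x - y) + y (P - Q).  So P moves x only a little when
    y is near x and Y is near X, which is what makes incidence of vectors and
    lines a closed relation. *)
Lemma vnorm_proj_sub_le (R : realType) (n : nat) (N : vector_norm R n)
    (X Y : Gr1 N) (x y : 'rV[R]_n) :
  line_set Y y ->
  N (x *m orth_proj (val X) - x)
    <= (opnorm N (orth_proj (val X)) + 1) * N (x - y) + Theta X Y * N y.
Proof.
move=> /(orth_proj_id (valP Y)) yY.
set P := orth_proj (val X); set Q := orth_proj (val Y) in yY *.
have -> : x *m P - x = (x - y) *m P - (x - y) + y *m (P - Q).
  rewrite mulmxBl mulmxBr yY; move: (x *m P) (y *m P) => u v.
  by rewrite opprB [RHS]addrC addrA [X in _ = X + _]addrC !subrKA.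
apply: le_trans (vnorm_triangle _ _ _) _.
apply: lerD; last exact: vnorm_mulmx_le.
apply: le_trans (vnorm_triangle _ _ _) _.
by rewrite mulrDl mul1r vnormN lerD2r vnorm_mulmx_le.
Qed.

Lemma near_vnorm_sub (R : realType) (n : nat) (N : vector_norm R n)
    (x : 'rV[R]_n) (d : R) :
  0 < d -> \forall y \near x, N (x - y) < d.
Proof.
move=> d0.
have [C C0 HC] := vnorm_le_mx_norm N.
have C1 : 0 < C + 1 by rewrite ltr_pwDr.
apply/nbhs_ballP; exists (d / (C + 1)) => /=; first by rewrite divr_gt0.
move=> y; rewrite -ball_normE /= ltr_pdivlMr// => xy.
apply: le_lt_trans (HC _) _; apply: le_lt_trans xy.
by rewrite mulrC ler_wpM2l// lerDl.
Qed.

Lemma closed_incidence (R : realType) (n : nat) (N : vector_norm R n) :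
  closed [set q : 'rV[R]_n * Gr1 N | line_set q.2 q.1].
Proof.
move=> [x X] clX /=.
set P := orth_proj (val X).
suff xP : x *m P = x.
  by rewrite /line_set /= -xP; have [] := orth_projP (valP X) x.
apply/eqP; rewrite -subr_eq0; apply/eqP/(@vnorm_eq0 _ _ N)/eqP.
rewrite eq_le vnorm_ge0 andbT; apply/ler_addgt0Pl => e e0; rewrite addr0.
pose C := opnorm N P + 1 + (N x + 1).
have C0 : 0 < C.
  by rewrite addr_gt0 ?ltr_wpDl ?opnorm_ge0 ?vnorm_ge0.
pose d := Num.min 1 (e / C).
have d0 : 0 < d by rewrite lt_min ltr01 divr_gt0.
have near_x : \forall y \near x, N (x - y) < d by exact: near_vnorm_sub.
have near_X : \forall Y \near X, Theta X Y < d by exact: (nbhsx_ballx X d d0).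
have [[y Y] /= [yY [xy XY]]] :
    [set q : 'rV[R]_n * Gr1 N | line_set q.2 q.1] `&`
    [set q | N (x - q.1) < d /\ Theta X q.2 < d] !=set0.
  by apply: clX; exists ([set y | N (x - y) < d], [set Y | Theta X Y < d]).
apply: le_trans (vnorm_proj_sub_le X x yY) _.
have Ny : N y <= N x + 1.
  have -> : y = x - (x - y) by rewrite opprB addrC subrK.
  apply: le_trans (vnorm_triangle _ _ _) _.
  by rewrite vnormN lerD2l (le_trans (ltW xy))// ge_min lexx.
apply: (@le_trans _ _ (C * d)).
  rewrite /C [leRHS]mulrDl; apply: lerD.
    by rewrite ler_wpM2l ?addr_ge0 ?opnorm_ge0// ltW.
  by rewrite mulrC ler_pM ?vnorm_ge0 ?opnorm_ge0// ltW.
by rewrite mulrC -ler_pdivlMr// ge_min lexx orbT.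
Qed.

Lemma vnorm_gt0 (R : realType) (n : nat) (N : vector_norm R n) x :
  x != 0 -> 0 < N x.
Proof.
move=> x0; rewrite lt_def vnorm_ge0 andbT.
by apply: contra x0 => /eqP/vnorm_eq0 ->.
Qed.

Lemma unit_sphere_neq0 (R : realType) (n : nat) (N : vector_norm R n) x :
  unit_sphere N x -> x != 0.
Proof.
move=> Nx; apply/eqP => x0.
by move: Nx; rewrite /unit_sphere /= x0 vnorm0 => /eqP; rewrite eq_sym oner_eq0.
Qed.

Lemma vnorm_scale_unit (R : realType) (n : nat) (N : vector_norm R n) r x :
  unit_sphere N x -> 0 < r -> N (r *: x) = r.
Proof. by move=> Nx r0; rewrite vnormZ Nx mulr1 gtr0_norm. Qed.

Lemma compact_unit_sphere (R : realType) (n : nat) (N : vector_norm R n) :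
  compact (unit_sphere N).
Proof.
have [c c0 Hc] := mx_norm_le_vnorm N.
apply: bounded_closed_compact.
  exists c^-1; split=> [|M cM x /= Nx]; first exact: num_real.
  rewrite (le_trans _ (ltW cM))// -(ler_pM2l c0) divff ?gt_eqF//.
  by rewrite (le_trans (Hc x))// Nx.
have -> : unit_sphere N = N @^-1` [set 1] by [].
apply: closed_comp; last exact: closed_eq.
by move=> x _; exact: vnorm_continuous.
Qed.

(** The closed incidence relation cuts a compact piece out of the product of the
    sphere and K, and the set in question is the first projection of that
    piece. *)
Lemma compact_unit_vectors (R : realType) (n : nat) (N : vector_norm R n)
    (K : set (Gr1 N)) :
  compact K ->
  compact [set x | unit_sphere N x /\ exists2 X, K X & line_set X x].
Proof.
move=> cK.
have cG := compact_closedI (compact_setX (@compact_unit_sphere _ _ N) cK)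
  (@closed_incidence _ _ N).
have := continuous_compact
  (continuous_subspaceT (fun q => @cvg_fst _ _ _ _ (nbhs_filter q.2))) cG.
congr compact; apply/seteqP; split => [_ [[x X] [[/= Sx KX] xX] <-]|].
  by split=> //; exists X.
by move=> x [Sx [X KX xX]]; exists (x, X).
Qed.

Lemma compact_closure_offdiag (R : realType) (I : set R) :
  compact I -> compact (closure (offdiag I)).
Proof.
move=> cI; have cII := compact_setX cI cI.
apply: (subclosed_compact (@closed_closure _ _) cII).
have /closure_id -> : closed (I `*` I).
  by apply: compact_closed => //; exact: norm_hausdorff.
by apply: closure_subset => p [].
Qed.

(** * Growth rates of the linearization *)

(** Sign conditions on lines become uniform on a compact set of lines: the
    minimum of g over the compact set of pairs of a unit vector on a line of K
    and a point of T is attained.  The stable case applies this to the negated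
    growth rate. *)
Lemma positive_gap (R : realType) (n : nat) (N : vector_norm R n)
    (T : set (R * R)) (g : 'rV[R]_n * (R * R) -> R) (K : set (Gr1 N)) :
  compact T -> {within unit_sphere N `*` T, continuous g} -> compact K ->
  (forall X x p, K X -> line_set X x -> unit_sphere N x -> T p ->
    0 < g (x, p)) ->
  exists2 d : R, 0 < d & forall X x p,
    K X -> line_set X x -> unit_sphere N x -> T p -> d <= g (x, p).
Proof.
move=> cT cg /compact_unit_vectors cU gpos.
set U := [set x | _] in cU.
have [UT0|/set0P UT0] := eqVneq (U `*` T) set0.
  exists 1 => // X x p KX xX Sx Tp.
  have : (U `*` T) (x, p) by split=> //; split=> //; exists X.
  by rewrite UT0.
have UTS : U `*` T `<=` unit_sphere N `*` T by move=> q [[]].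
have [[x p]] := compact_EVT_min UT0 (compact_setX cU cT)
  (continuous_subspaceW UTS cg).
rewrite inE => -[/= [Sx [X KX xX]] Tp] gmin.
exists (g (x, p)) => [|Y y q KY yY Sy Tq]; first exact: gpos KX xX Sx Tp.
by apply: gmin; rewrite inE; split=> //; split=> //; exists Y.
Qed.

Lemma growth_extP (R : realType) (n : nat) (N : vector_norm R n)
    (I : set R) (tm : R) (Phi : R -> R -> 'M[R]_n) :
  in_LP N I tm Phi -> growth_extension N I tm Phi (growth_ext N I tm Phi).
Proof. by case=> _ ex; exact: xgetPex. Qed.

(** A negative value of lambda_max is a genuine maximum, as the default value
    for a missing maximum is 0. *)
Lemma stable_cone_growth_lt0 (R : realType) (n : nat) (N : vector_norm R n)
    (I : set R) (tm : R) (Phi : R -> R -> 'M[R]_n) x p :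
  stable_cone N I tm Phi x -> unit_sphere N x -> closure (offdiag I) p ->
  growth_ext N I tm Phi (x, p) < 0.
Proof.
move=> [X /= lX xX] Sx Ip; apply: le_lt_trans (lX).
move: lX; rewrite /lambda_max /set_max.
case: xgetP => [a _ [_ ub] _|_]; last by rewrite ltxx.
by apply: ub; exists (x, p).
Qed.

(** As in the stable case, the default value 0 cannot be mistaken for a positive
    minimum. *)
Lemma unstable_cone_growth_gt0 (R : realType) (n : nat) (N : vector_norm R n)
    (I : set R) (tm : R) (Phi : R -> R -> 'M[R]_n) x p :
  unstable_cone N I tm Phi x -> unit_sphere N x -> closure (offdiag I) p ->
  0 < growth_ext N I tm Phi (x, p).
Proof.
move=> [X /= lX xX] Sx Ip; apply: lt_le_trans (lX) _.
move: lX; rewrite /lambda_min /set_min.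
case: xgetP => [a _ [_ lb] _|_]; last by rewrite ltxx.
by apply: lb; exists (x, p).
Qed.

(** Scaling the initial vector adds the same constant to both logarithms. *)
Lemma growth_linearZ (R : realType) (n : nat) (N : vector_norm R n)
    (I : set R) (tm : R) (Phi : R -> R -> 'M[R]_n) r x p :
  is_linear_process N I Phi -> I tm -> 0 < r -> x != 0 -> offdiag I p ->
  growth N tm (lin_process Phi) (r *: x) p = growth N tm (lin_process Phi) x p.
Proof.
move=> [_ invPhi _] Itm r0 x0 [It Is _].
have pos t : I t -> 0 < N (x *m Phi t tm).
  move=> It'; apply: vnorm_gt0; apply: contra x0 => /eqP xPhi.
  by rewrite -(mulmxK (invPhi _ _ It' Itm) x) xPhi mul0mx.
rewrite /growth /Delta /lin_process -!scalemxAl !vnormZ !gtr0_norm//.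
by rewrite !lnM ?posrE ?pos// opprD addrACA subrr add0r.
Qed.

(** * Transfer to the process *)

(** Finiteness of a and b comes for free: if either is infinite, the difference
    has absolute value +oo, since +oo - +oo = -oo in these conventions. *)
Lemma lt0_of_abse_lt (R : realType) (a b : \bar R) (d : R) :
  (`|a - b| < d%:E)%E -> (b <= (- d)%:E)%E -> (a < 0)%E.
Proof.
case: a b => [a| |] [b| |] //=.
rewrite !lte_fin lee_fin ltr_norml => /andP[_ abd] bd.
by rewrite -(subrK b a) -(subrr d) ltr_leD.
Qed.

Lemma gt0_of_abse_lt (R : realType) (a b : \bar R) (d : R) :
  (`|a - b| < d%:E)%E -> (d%:E <= b)%E -> (0 < a)%E.
Proof.
case: a b => [a| |] [b| |] //=.
rewrite !lte_fin lee_fin ltr_norml => /andP[abd _] bd.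
by rewrite -(subrK b a) -(addNr d) ltr_leD.
Qed.

(** Being a supremum over the ball of radius r0, the value m(r0) controls all
    smaller radii as well; r0 is any radius with m(r0) < d. *)
Lemma rate_deviation_near0 (R : realType) (n : nat) (N : vector_norm R n)
    (I : set R) (tm : R)
    (phi : R -> R -> 'rV[R]_n -> 'rV[R]_n) (Phi : R -> R -> 'M[R]_n) (d : R) :
  rate_deviation N I tm phi Phi r @[r --> within `[0, +oo[ (nbhs (0 : R))]
    --> rate_deviation N I tm phi Phi 0 ->
  0 < d ->
  exists2 r0 : R, 0 < r0 & forall x, x != 0 -> N x <= r0 ->
    (`|mu_inf N I tm phi x - mu_inf N I tm (lin_process Phi) x| < d%:E)%E /\
    (`|mu_sup N I tm phi x - mu_sup N I tm (lin_process Phi) x| < d%:E)%E.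
Proof.
move=> cm d0.
have m0 : rate_deviation N I tm phi Phi 0 = 0%E by rewrite /rate_deviation ltxx.
have small : nbhs (rate_deviation N I tm phi Phi 0) [set y | (y < d%:E)%E].
  by rewrite m0; apply: open_ereal_lt'; rewrite lte_fin.
have /nbhs_ballP[e /= e0 He] := cm _ small.
exists (e / 2) => [|x x0 Nx]; first by rewrite divr_gt0.
have e20 : 0 < e / 2 by rewrite divr_gt0.
have : (rate_deviation N I tm phi Phi (e / 2) < d%:E)%E.
  apply: (He (e / 2)); last by rewrite /= in_itv /= andbT ltW.
  rewrite -ball_normE /= sub0r normrN gtr0_norm//.
  by rewrite ltr_pdivrMr// ltr_pMr// ltr1n.
rewrite /rate_deviation e20 => mr.
apply/andP; rewrite -gt_max; apply: le_lt_trans mr.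
by apply: ereal_sup_ubound; exists x.
Qed.

Lemma exit_radius_ge (R : realType) (n : nat) (N : vector_norm R n)
    (W : set 'rV[R]_n) (X : Gr1 N) (r0 : R) :
  (forall x r, line_set X x -> unit_sphere N x -> 0 < r -> r <= r0 ->
    W (r *: x)) ->
  (r0%:E <= exit_radius W X)%E.
Proof.
move=> HW; apply/ereal_infP => _ [r [r_gt0 [x [xX Sx nW]]] <-].
rewrite lee_fin leNgt; apply/negP => /ltW rr0.
exact/nW/HW.
Qed.

(** On K the growth rates of the linearization are at most -d, at every distance
    from the origin because they are invariant under scaling.  Where the rates
    of phi differ from these by less than d they are still negative, so any r0
    with m(r0) < d is a lower bound for the exit radii. *)
Lemma attraction_radius_bound (R : realType) (n : nat) (N : vector_norm R n)
    (I : set R) (tm : R)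
    (phi : R -> R -> 'rV[R]_n -> 'rV[R]_n) (Phi : R -> R -> 'M[R]_n)
    (K : set (Gr1 N)) :
  compact I -> I tm -> in_LP N I tm Phi ->
  rate_deviation N I tm phi Phi r @[r --> within `[0, +oo[ (nbhs (0 : R))]
    --> rate_deviation N I tm phi Phi 0 ->
  compact K -> K `<=` lines_in (stable_cone N I tm Phi) ->
  exists2 e : R, 0 < e & forall X, K X ->
    (e%:E <= exit_radius (attraction_domain N I tm phi) X)%E.
Proof.
move=> cI Itm LP cm cK KV.
have [cD Dgrowth] := growth_extP LP.
set D := growth_ext N I tm Phi in cD Dgrowth.
have [X x p KX xX Sx Ip|d d0 Hd] := @positive_gap _ _ N _ (fun q => - D q) _
    (compact_closure_offdiag cI) (fun q => continuousN (cD q)) cK.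
  by rewrite oppr_gt0; apply: stable_cone_growth_lt0 Sx Ip; exact: KV xX.
have [r0 r00 Hr0] := rate_deviation_near0 cm d0.
exists r0 => // X KX; apply: exit_radius_ge => x r xX Sx r_gt0 rr0.
have x0 := unit_sphere_neq0 Sx.
have rx0 : r *: x != 0 by rewrite scaler_eq0 negb_or x0 gt_eqF.
left; split=> //.
have [|_ dev] := Hr0 _ rx0; first by rewrite (vnorm_scale_unit Sx).
apply: lt0_of_abse_lt dev _; apply/ereal_supP => _ [p Ip <-].
rewrite lee_fin (growth_linearZ LP.1)// -Dgrowth// lerNr.
by apply: Hd xX Sx _ => //; exact: subset_closure.
Qed.

Lemma repulsion_radius_bound (R : realType) (n : nat) (N : vector_norm R n)
    (I : set R) (tm : R)
    (phi : R -> R -> 'rV[R]_n -> 'rV[R]_n) (Phi : R -> R -> 'M[R]_n)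
    (K : set (Gr1 N)) :
  compact I -> I tm -> in_LP N I tm Phi ->
  rate_deviation N I tm phi Phi r @[r --> within `[0, +oo[ (nbhs (0 : R))]
    --> rate_deviation N I tm phi Phi 0 ->
  compact K -> K `<=` lines_in (unstable_cone N I tm Phi) ->
  exists2 e : R, 0 < e & forall X, K X ->
    (e%:E <= exit_radius (repulsion_domain N I tm phi) X)%E.
Proof.
move=> cI Itm LP cm cK KV.
have [cD Dgrowth] := growth_extP LP.
have [X x p KX xX Sx Ip|d d0 Hd] :=
    positive_gap (compact_closure_offdiag cI) cD cK.
  by apply: unstable_cone_growth_gt0 Sx Ip; exact: KV xX.
have [r0 r00 Hr0] := rate_deviation_near0 cm d0.
exists r0 => // X KX; apply: exit_radius_ge => x r xX Sx r_gt0 rr0.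
have x0 := unit_sphere_neq0 Sx.
have rx0 : r *: x != 0 by rewrite scaler_eq0 negb_or x0 gt_eqF.
left; split=> //.
have [|dev _] := Hr0 _ rx0; first by rewrite (vnorm_scale_unit Sx).
apply: gt0_of_abse_lt dev _; apply/ereal_infP => _ [p Ip <-].
rewrite lee_fin (growth_linearZ LP.1)// -Dgrowth//.
by apply: Hd xX Sx _ => //; exact: subset_closure.
Qed.

Theorem theorem4p12 (R : realType) (n : nat) (N : vector_norm R n)
    (I : set R) (tm tp : R)
    (phi : R -> R -> 'rV[R]_n -> 'rV[R]_n) (Phi : R -> R -> 'M[R]_n) :
  (1 <= n)%N ->
  compact I -> I tm -> lbound I tm -> I tp -> ubound I tp -> tm < tp ->
  is_C1_process N I phi ->
  (forall t, I t -> phi t tm 0 = 0) ->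
  in_LP N I tm Phi ->
  (forall t s, I t -> I s -> Phi t s = linearization tm phi 0 t s) ->
  rate_deviation N I tm phi Phi r @[r --> within `[0, +oo[ (nbhs (0 : R))]
    --> rate_deviation N I tm phi Phi 0 ->
  (forall X Y : Gr1 N,
      line_set X `<=` stable_cone N I tm Phi ->
      line_set Y `<=` unstable_cone N I tm Phi ->
      (0 < exit_radius (attraction_domain N I tm phi) X)%E /\
      (0 < exit_radius (repulsion_domain N I tm phi) Y)%E) /\
  (forall K : set (Gr1 N), compact K ->
      K `<=` lines_in (stable_cone N I tm Phi) ->
      exists2 e : R, 0 < e & forall X, K X ->
        (e%:E <= exit_radius (attraction_domain N I tm phi) X)%E) /\
  (forall K : set (Gr1 N), compact K ->
      K `<=` lines_in (unstable_cone N I tm Phi) ->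
      exists2 e : R, 0 < e & forall X, K X ->
        (e%:E <= exit_radius (repulsion_domain N I tm phi) X)%E).
Proof.
move=> _ cI Itm _ _ _ _ _ _ LP _ cm.
have attr := attraction_radius_bound cI Itm LP cm.
have rep := repulsion_radius_bound cI Itm LP cm.
split=> // X Y XV YV; split.
  have [|e e0 He] := attr [set X] (@compact_set1 _ X); first by move=> _ ->.
  by apply: lt_le_trans (He X erefl); rewrite lte_fin.
have [|e e0 He] := rep [set Y] (@compact_set1 _ Y); first by move=> _ ->.
by apply: lt_le_trans (He Y erefl); rewrite lte_fin.
Qed.
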